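(* Let $q$ be a prime power, $n$ a positive integer, and let $u_1,\dots,u_n$ and $v_1,\dots,v_n$ be a dual pair of ordered bases of $\mathbb{F}_{q^n}$ over $\mathbb{F}_q$. Let $f(x)\in\mathbb{F}_{q^n}[x]$ be a permutation polynomial over $\mathbb{F}_{q^n}$, put $f_i(x)=\mathrm{Tr}(v_if(x))$ for $1\le i\le n$, let $h_i(x)\in\mathbb{F}_q[x]$, $1\le i\le n$, be regarded as maps from $\mathbb{F}_q$ to $\mathbb{F}_q$, and let $a_1,\dots,a_n\in\mathbb{F}_{q^n}$. Then the polynomial $$F(x)=a_1h_1(f_1(x))+\dots+a_nh_n(f_n(x))$$ is a permutation polynomial over $\mathbb{F}_{q^n}$ if and only if the following two conditions hold: (1) $a_1,\dots,a_n$ is a basis of $\mathbb{F}_{q^n}$ over $\mathbb{F}_q$; (2) $h_i(x)$, $1\le i\le n$, are permutation polynomials over $\mathbb{F}_q$. Moreover, when these conditions hold, if $f^{-1}(x)$ and $h_i^{-1}(x)$ ($1\le i\le n$) are the compositional inverses of $f(x)$ and $h_i(x)$ respectively, and $b_1,\dots,b_n$ is the dual basis of $a_1,\dots,a_n$, then $$F^{-1}(x)=f^{-1}\left(\sum_{i=1}^nu_ih_i^{-1}(\mathrm{Tr}(b_ix))\right).$$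
   Context: $\mathrm{Tr}(x)=x+x^q+\dots+x^{q^{n-1}}$ is the trace from $\mathbb{F}_{q^n}$ to $\mathbb{F}_q$. Two ordered bases $u_1,\dots,u_n$ and $v_1,\dots,v_n$ of $\mathbb{F}_{q^n}$ over $\mathbb{F}_q$ are dual if $\mathrm{Tr}(u_iv_j)=1$ when $i=j$ and $0$ otherwise. A polynomial over a finite field $K$ is identified with the map $K\to K$ it induces (i.e. taken modulo $x^{|K|}-x$); it is a permutation polynomial over $K$ if this map is a bijection, and its compositional inverse is the polynomial (modulo $x^{|K|}-x$) inducing the inverse map. *)

(* Defs.v *)
From HB Require Import structures.
From mathcomp Require Import all_boot all_order all_algebra all_field.

Set Implicit Arguments.
Unset Strict Implicit.
Unset Printing Implicit Defensive.

Import GRing.Theory.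
Local Open Scope ring_scope.

(* Stated over any ring so that it applies both to elements of F_(q^n) and,
   formally, to polynomials: evaluating Tr q n p at x gives Tr q n p.[x].
   The trace is kept in F_(q^n), of which F_q is regarded as a subfield. *)
Definition Tr (q n : nat) (A : nzRingType) (x : A) : A :=
  \sum_(k < n) x ^+ (q ^ k)%N.

Definition dual_bases (Fq : finFieldType) (L : fieldExtType Fq) (q n : nat)
    (u v : n.-tuple L) : Prop :=
  [/\ basis_of {:L} u, basis_of {:L} v &
      forall i j : 'I_n, Tr q n (tnth u i * tnth v j) = (i == j)%:R].

Definition permutation_poly (K : fieldType) (p : {poly K}) : Prop :=
  bijective (fun x : K => p.[x]).

(* Polynomials over a finite field K are taken modulo 'X^|K| - 'X, that is, up
   to equality of the induced maps; p determines its compositional inverse g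
   only up to this congruence, hence a relation rather than a function. *)
Definition compositional_inverse (K : fieldType) (p g : {poly K}) : Prop :=
  cancel (fun x : K => p.[x]) (fun x : K => g.[x]) /\
  cancel (fun x : K => g.[x]) (fun x : K => p.[x]).

Definition lift_poly (Fq : fieldType) (L : fieldExtType Fq) (h : {poly Fq}) :
  {poly L} := map_poly (in_alg L) h.

(* Main.v *)
Require Import Defs.
From HB Require Import structures.
From mathcomp Require Import all_boot all_order all_algebra all_field.

Set Implicit Arguments.
Unset Strict Implicit.
Unset Printing Implicit Defensive.

Import GRing.Theory.
Local Open Scope ring_scope.

(** By duality Tr (v_i x) is the i-th coordinate of x in the basis u.
    Hence F factors as f, followed by the coordinate isomorphism
    F_(q^n) -> F_q^n, followed by h_1 x ... x h_n, followed by the linear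
    combination map F_q^n -> F_(q^n) with coefficients a_i. Bijectivity of the
    composition forces the last map to be onto, so that a is a basis, and then
    every h_i is onto, hence bijective as F_q is finite. *)

Section Trace.

Variables (Fq : finFieldType) (L : fieldExtType Fq).

(** This power map is an iterate of the Frobenius: [L] has the characteristic p of [Fq], and [#|Fq|]
    is a power of p because the additive group of [Fq] is a p-group. *)
Lemma expr_cardD (k : nat) (x y : L) :
  (x + y) ^+ (#|Fq| ^ k)%N = x ^+ (#|Fq| ^ k)%N + y ^+ (#|Fq| ^ k)%N.
Proof.
apply: exprDn_pchar; rewrite pnatX (eq_pnat _ (pchar_lalg L)).
have [p p_pr pFq] := finPcharP Fq.
rewrite (eq_pnat _ (pcharf_eq pFq)) -cardsT.
by rewrite [_.-nat _](pprimeChar_pgroup pFq).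
Qed.

Lemma scale_expr_card (k : nat) (c : Fq) (x : L) :
  (c *: x) ^+ (#|Fq| ^ k)%N = c *: x ^+ (#|Fq| ^ k)%N.
Proof.
rewrite exprZn; congr (_ *: _).
by elim: k => [|k IHk]; rewrite ?expr1 // expnS exprM expf_card.
Qed.

Lemma Tr_linear (n : nat) : linear (@Tr #|Fq| n L).
Proof.
move=> c x y; rewrite /Tr scaler_sumr -big_split /=.
by apply: eq_bigr => k _; rewrite expr_cardD scale_expr_card.
Qed.

HB.instance Definition _ (n : nat) :=
  GRing.isLinear.Build Fq L L *:%R (@Tr #|Fq| n L) (Tr_linear n).

(** Expand [x] in the basis [u]: by linearity and duality the trace kills every term except the
    [i]-th. *)
Lemma Tr_dual_coord (n : nat) (u v : n.-tuple L) (i : 'I_n) (x : L) :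
  dual_bases #|Fq| u v -> Tr #|Fq| n (tnth v i * x) = (coord u i x)%:A.
Proof.
case=> bu _ uv; rewrite {1}(coord_basis bu (memvf x)) mulr_sumr linear_sum /=.
rewrite (bigD1 i) //= big1 ?addr0 => [|j ne_ji]; rewrite -scalerAr linearZ /=.
  by rewrite -tnth_nth mulrC uv eqxx.
by rewrite -tnth_nth mulrC uv (negPf ne_ji) scaler0.
Qed.

End Trace.

Lemma horner_Tr (L : fieldType) (q n : nat) (p : {poly L}) (x : L) :
  (Tr q n p).[x] = Tr q n p.[x].
Proof. by rewrite /Tr horner_sum; apply: eq_bigr => k _; rewrite horner_exp. Qed.

Lemma horner_lift_poly (Fq : fieldType) (L : fieldExtType Fq)
    (h : {poly Fq}) (c : Fq) : (lift_poly L h).[c%:A] = h.[c]%:A.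
Proof. exact: (horner_map (in_alg L)). Qed.

(** The traces are scalars [c%:A], on which a lifted polynomial takes the value computed in [Fq].
    This serves both for F and, with [f] equal to ['X], for the inner sum of the inverse formula. *)
Lemma horner_coord_poly (Fq : finFieldType) (L : fieldExtType Fq) (n : nat)
    (u v a : n.-tuple L) (h : 'I_n -> {poly Fq}) (f : {poly L}) (x : L) :
  dual_bases #|Fq| u v ->
  (\sum_(i < n) tnth a i *:
     (lift_poly L (h i) \Po Tr #|Fq| n (tnth v i *: f))).[x] =
  \sum_(i < n) (h i).[coord u i f.[x]] *: a`_i.
Proof.
move=> uv; rewrite horner_sum; apply: eq_bigr => i _.
rewrite hornerZ horner_comp horner_Tr hornerZ (Tr_dual_coord _ _ uv).
by rewrite horner_lift_poly mulr_algr (tnth_nth 0).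
Qed.

Section ComponentwiseMap.

Variables (Fq : finFieldType) (L : fieldExtType Fq) (n : nat).
Variables (u a : n.-tuple L).

(** As [a] is free, the [a]-coordinates of the image are exactly the values of the [h i], which the
    [g i] undo. Exchanging [u] with [a] and [h] with [g] gives the other cancellation. *)
Lemma componentwise_mapK (h g : 'I_n -> Fq -> Fq) :
    basis_of {:L} u -> basis_of {:L} a -> (forall i, cancel (h i) (g i)) ->
  cancel (fun x => \sum_(i < n) h i (coord u i x) *: a`_i)
         (fun x => \sum_(i < n) g i (coord a i x) *: u`_i).
Proof.
move=> bu ba hK x; rewrite [RHS](coord_basis bu (memvf x)).
by apply: eq_bigr => i _; rewrite coord_sum_free ?(basis_free ba) // hK.
Qed.

Lemma componentwise_map_onto (h : 'I_n -> Fq -> Fq) :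
    \dim {:L} = n ->
    (forall y, exists x, y = \sum_(i < n) h i (coord u i x) *: a`_i) ->
  basis_of {:L} a /\ forall i, bijective (h i).
Proof.
move=> dimL onto.
have ba : basis_of {:L} a.
  rewrite basisEdim size_tuple dimL leqnn andbT.
  (* Surjectivity makes [a] a spanning family, and its size is the dimension. *)
  apply/subvP=> y _; have [x ->] := onto y.
  apply: memv_suml => i _; apply/memvZ/memv_span/mem_nth.
  by rewrite size_tuple.
split=> // i.
(* Take a preimage of [c *: a_i] and compare the [i]-th coordinates in [a]. *)
have ontoi c : exists d, h i d == c.
  have [x /(congr1 (coord a i))] := onto (c *: a`_i).
  rewrite linearZ /= coord_free ?(basis_free ba) // eqxx mulr1.
  by rewrite coord_sum_free ?(basis_free ba) // => ->; exists (coord u i x).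
(* A section of [h i] is injective, hence bijective on the finite field, so [h i] is its inverse. *)
pose g c := xchoose (ontoi c).
have gK : cancel g (h i) by move=> c; apply/eqP/(xchooseP (ontoi c)).
exact: (bij_can_bij (injF_bij (can_inj gK)) gK).
Qed.

End ComponentwiseMap.

Theorem theorem1p2 (q n : nat) (Fq : finFieldType) (L : fieldExtType Fq)
    (hq : #|Fq| = q) (hn : \dim {:L} = n)
    (u v : n.-tuple L) (huv : dual_bases q u v)
    (f : {poly L}) (hf : permutation_poly f)
    (h : 'I_n -> {poly Fq}) (a : n.-tuple L) :
  let fi (i : 'I_n) : {poly L} := Tr q n (tnth v i *: f) in
  let F : {poly L} :=
    \sum_(i < n) tnth a i *: (lift_poly L (h i) \Po fi i) in
  (permutation_poly F <->
     basis_of {:L} a /\ (forall i : 'I_n, permutation_poly (h i))) /\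
  (basis_of {:L} a -> (forall i : 'I_n, permutation_poly (h i)) ->
   forall (finv : {poly L}) (hinv : 'I_n -> {poly Fq}) (b : n.-tuple L),
     compositional_inverse f finv ->
     (forall i : 'I_n, compositional_inverse (h i) (hinv i)) ->
     dual_bases q a b ->
     compositional_inverse F
       (finv \Po
         (\sum_(i < n)
            tnth u i *: (lift_poly L (hinv i) \Po Tr q n (tnth b i *: 'X))))).
Proof.
move=> fi F.
rewrite -hq in huv fi F *.
have FE x : F.[x] = \sum_(i < n) (h i).[coord u i f.[x]] *: a`_i.
  exact: horner_coord_poly huv.
have [bu _ _] := huv.
split; first split.
- case=> G FK GK; apply: (@componentwise_map_onto _ _ _ u a
    (fun i c => (h i).[c])) => // y.
  by exists f.[G y]; rewrite -FE GK.
- case=> ba bij_h.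
  (* Finite choice over the indices gathers the separate inverses into one family. *)
  have /fin_all_exists[g gP] i : exists g : Fq -> Fq,
      cancel (fun c => (h i).[c]) g /\ cancel g (fun c => (h i).[c]).
    by have [g hK gK] := bij_h i; exists g.
  pose H x := \sum_(i < n) (h i).[coord u i x] *: a`_i.
  suff bij_H : bijective H.
    by apply: (eq_bij (bij_comp bij_H hf)) => x; rewrite FE.
  exists (fun x => \sum_(i < n) g i (coord a i x) *: u`_i).
    apply: (componentwise_mapK (h := fun i c => (h i).[c])) => // i.
    exact: (gP i).1.
  apply: (componentwise_mapK (g := fun i c => (h i).[c])) => // i.
  exact: (gP i).2.
- move=> ba _ finv hinv b [fK finvK] hinvP ab.
  (* The dual pair is now [a], [b]: the traces against [b] read off coordinates in [a]. *)
  have GE x :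
      (\sum_(i < n) tnth u i *:
         (lift_poly L (hinv i) \Po Tr #|Fq| n (tnth b i *: 'X))).[x] =
      \sum_(i < n) (hinv i).[coord a i x] *: u`_i.
    by rewrite (horner_coord_poly _ _ _ _ ab) hornerX.
  (* F is the componentwise map after [f], so its inverse is [finv] after the componentwise map of
     the [hinv i]; each direction cancels the two layers in turn. *)
  split=> x; rewrite horner_comp GE FE.
    rewrite (componentwise_mapK (h := fun i c => (h i).[c])
      (g := fun i c => (hinv i).[c])) ?fK // => i; exact: (hinvP i).1.
  rewrite finvK (componentwise_mapK (h := fun i c => (hinv i).[c])
    (g := fun i c => (h i).[c])) // => i; exact: (hinvP i).2.
Qed.
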